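(* Let $r:\mathbb R\to(0,\infty)$ be continuous and let $0\le q\in L_1^{\rm loc}(\mathbb R)$. Suppose that there exists $a\in(0,\infty)$ such that $$\inf_{x\in\mathbb R}\int_{x-a}^{x+a}\frac{q(t)}{r(t)}\,dt>0 .$$ Then the problem $$-r(x)y'(x)+q(x)y(x)=f(x),\quad x\in\mathbb R,\qquad \lim_{|x|\to\infty}y(x)=0$$ is correctly solvable in $L_1(\mathbb R)$ if and only if $r_0:=\inf_{x\in\mathbb R}r(x)>0$. Moreover, $\|G\|_{1\to1}\le c\,r_0^{-1}d_0$ with an absolute constant $c>0$, where $d_0=\sup_{x\in\mathbb R}d(x)$ (the right-hand side being understood as $+\infty$ if $r_0=0$).
   Context: $L_1(\mathbb R)$ is the usual Lebesgue space with norm $\|\cdot\|_1$. A solution of the problem (for given $f\in L_1(\mathbb R)$) is any function $y$ on $\mathbb R$, absolutely continuous on every compact interval, that satisfies the differential equation almost everywhere on $\mathbb R$ and satisfies $y(x)\to0$ as $|x|\to\infty$. The problem is called correctly solvable in $L_1(\mathbb R)$ if (I) for every $f\in L_1(\mathbb R)$ there exists a unique solution $y\in L_1(\mathbb R)$, and (II) there is a constant $c_1\in(0,\infty)$, independent of $f$, such that $\|y\|_1\le c_1\|f\|_1$ for all $f\in L_1(\mathbb R)$. For $x\in\mathbb R$, $d(x)=\inf\{d>0:\int_{x-d}^{x+d}\frac{q(t)}{r(t)}dt=2\}$ (well defined when $\int_{-\infty}^0\frac{q(t)}{r(t)}dt=\infty$, which is the case under the hypothesis of the theorem). $G$ is the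 integral operator $(Gf)(x)=\int_x^\infty\frac{1}{r(t)}\exp\big(-\int_x^t\frac{q(s)}{r(s)}ds\big)f(t)\,dt$, $x\in\mathbb R$, and $\|G\|_{1\to1}$ is its operator norm on $L_1(\mathbb R)$. *)

(* Defs.v *)
From HB Require Import structures.
From mathcomp Require Import all_boot all_order all_algebra.
From mathcomp Require Import all_classical all_reals all_analysis.
Set Implicit Arguments.
Unset Strict Implicit.
Unset Printing Implicit Defensive.
Import Order.TTheory GRing.Theory Num.Theory.
Import numFieldNormedType.Exports.

Local Open Scope classical_set_scope.
Local Open Scope ring_scope.

(* Elements of L_1(R) and of L_1^loc(R) are given by Borel representatives
   R -> R; this loses nothing, since every class has one and every notion below
   only depends on f and q up to null sets. *)

Section absolute_continuity.
Context {R : realType}.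

Definition abs_continuous_itv (a b : R) (y : R -> R) : Prop :=
  forall e : R, 0 < e -> exists2 d : R, 0 < d &
    forall (n : nat) (u v : 'I_n -> R),
      (forall i, [/\ a <= u i, u i <= v i & v i <= b]) ->
      trivIset [set: 'I_n] (fun i => `]u i, v i[%classic) ->
      \sum_(i < n) (v i - u i) < d ->
      \sum_(i < n) `|y (v i) - y (u i)| < e.

Definition loc_abs_continuous (y : R -> R) : Prop :=
  forall a b : R, a <= b -> abs_continuous_itv a b y.

End absolute_continuity.

Section problem.
Context {R : realType}.
Local Notation mu := (@lebesgue_measure R).
Implicit Types r q f y : R -> R.

Definition norm1 (f : R -> R) : \bar R := 'N[mu]_1[EFin \o f]%E.

Definition is_solution r q f y : Prop :=
  [/\ loc_abs_continuous y,
      {ae mu, forall x : R, derivable y x 1 /\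
                            - r x * 'D_1 y x + q x * y x = f x},
      y x @[x --> +oo] --> (0 : R) &
      y x @[x --> -oo] --> (0 : R)].

Definition correctly_solvable r q : Prop :=
  (forall f, f \in Lfun mu 1 ->
     exists! y : R -> R, is_solution r q f y /\ y \in Lfun mu 1) /\
  (exists2 c1 : R, 0 < c1 &
     forall f y, f \in Lfun mu 1 ->
       is_solution r q f y -> y \in Lfun mu 1 ->
       (norm1 y <= c1%:E * norm1 f)%E).

Definition int_around r q (x d : R) : \bar R :=
  (\int[mu]_(t in `[(x - d)%R, (x + d)%R]) (q t / r t)%:E)%E.

(* The infimum is taken in the extended reals, so that the infimum of an empty
   set is +oo. *)
Definition d_fun r q (x : R) : \bar R :=
  ereal_inf [set d%:E | d in [set d : R | 0 < d /\ int_around r q x d = 2%:E]].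

Definition d0 r q : \bar R := ereal_sup (range (d_fun r q)).

Definition r0 r : R := inf (range r).

Definition G r q f (x : R) : \bar R :=
  (\int[mu]_(t in `[x, +oo[)
     ((r t)^-1 * expR (- \int[mu]_(s in `[x, t]) (q s / r s)) * f t)%:E)%E.

(* The least constant bounding an operator on L_1(R) (with values a priori
   extended-real functions); +oo if T does not map L_1(R) boundedly into
   itself. *)
Definition opnorm11 (T : (R -> R) -> R -> \bar R) : \bar R :=
  ereal_inf [set C%:E | C in [set C : R | 0 <= C /\
    forall f, f \in Lfun mu 1 ->
      mu.-integrable [set: R] (T f) /\
      ('N[mu]_1[T f] <= C%:E * norm1 f)%E]].

End problem.

(* Main.v *)
Require Import Defs.
From HB Require Import structures.
From mathcomp Require Import all_boot all_order all_algebra.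
From mathcomp Require Import all_classical all_reals all_analysis.
From mathcomp Require Import measurable_realfun ring lra.
Set Implicit Arguments.
Unset Strict Implicit.
Unset Printing Implicit Defensive.
Import Order.TTheory GRing.Theory Num.Theory.
Import numFieldNormedType.Exports.
Local Open Scope classical_set_scope.
Local Open Scope ring_scope.

(** The equation is linear of first order, and everything rests on the
    primitive [Q] of [q / r] ([potential]). A locally absolutely continuous
    function whose derivative vanishes almost everywhere is constant
    ([ae_derive0_constant]); applied to [y exp (- Q)] plus a primitive of
    [(f / r) exp (- Q)], this gives the variation of constants formula
    [y x exp (- Q x) - y t exp (- Q t) = \int_x^t (f / r) exp (- Q)] for
    every solution ([variation_of_constants]). As [Q] is nondecreasing, a
    solution that tends to 0 at [+oo] is therefore unique
    ([solution_unique]).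

    Sufficiency. If [Q] grows by at least [beta] over every window of length
    [2 * D], then [exp (Q x - Q t)] is at most [exp beta] times the
    exponential kernel of rate [lam = beta / (2 * D)] ([potential_expker]).
    When moreover [r >= rho > 0], the kernel of [G] is dominated by a
    multiple of that convolution kernel, whose integral over [x] is
    [1 / lam]. Tonelli then gives [|G f|_1 <= exp beta / (rho lam) |f|_1]
    ([green_norm1]), and dominated convergence gives [G f -> 0] at both
    infinities ([green_cvg]); hence [G f] is the solution. The hypothesis of
    the theorem provides such [D] and [beta]; the definition of [d0]
    provides [beta = 2] and [D = 2 d0], which yields the bound on the
    operator norm with [c = 2 exp 2] ([opnorm_G_le]).

    Necessity. If [inf r = 0], the values of [r] become small on intervals
    that go to infinity, and a gliding hump builds an integrable [f] for
    which no solution tends to 0 ([solvable_r0_gt0]). *)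

(** * Absolutely continuous functions with zero derivative *)

Section zero_derivative.
Context {R : realType}.
Local Notation mu := (@lebesgue_measure R).
Implicit Types y : R -> R.

(** Families are kept as a length and two sequences on [nat], not on
    ordinals: appending an interval is then a pointwise [if], with no change
    of type. *)
Definition ordered_itvs (n : nat) (u v : nat -> R) (a x : R) (U : set R) :=
  [/\ forall i, (i < n)%N -> [/\ a <= u i, u i <= v i & v i <= x],
      forall i j, (i < j)%N -> (j < n)%N -> v i <= u j &
      forall i, (i < n)%N -> `]u i, v i[ `<=` U].

Lemma ordered_itvs_rcons n u v a x z U :
  ordered_itvs n u v a x U -> a <= x -> x <= z -> `]x, z[ `<=` U ->
  ordered_itvs n.+1 (fun i => if (i < n)%N then u i else x)
    (fun i => if (i < n)%N then v i else z) a z U.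
Proof.
move=> [bd mono sub] ax xz xzU; split.
- move=> i _; case: ifPn => [ni|_]; last by split.
  by have [-> -> vx] := bd _ ni; split => //; exact: le_trans xz.
- move=> i j ij; rewrite ltnS => jn.
  rewrite (leq_trans ij jn); case: ifPn => jn'; first exact: mono.
  by have [] := bd i (leq_trans ij jn).
- by move=> i _; case: ifPn => [/sub|].
Qed.

Lemma ordered_itvs_trivIset n u v a x U :
  ordered_itvs n u v a x U ->
  trivIset [set: 'I_n] (fun i => `]u i, v i[%classic).
Proof.
move=> [_ mono _]; apply/trivIsetP => i j _ _.
wlog : i j / (i < j)%N => [wl ij|ij _].
  have [lij|ji|/val_inj e] := ltngtP i j.
  - exact: wl lij ij.
  - by rewrite setIC; apply: wl => //; rewrite eq_sym.
  - by rewrite e eqxx in ij.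
rewrite -subset0 => z [/=]; rewrite !in_itv/= => /andP[_ zv] /andP[uz _].
have := mono i j ij (ltn_ord j); lra.
Qed.

Lemma measure_disjoint_itvs n (u v : 'I_n -> R) :
  (forall i, u i <= v i) ->
  trivIset [set: 'I_n] (fun i => `]u i, v i[%classic) ->
  mu (\big[setU/set0]_(i < n) `]u i, v i[%classic) =
  (\sum_(i < n) (v i - u i))%:E.
Proof.
move=> uv tI; rewrite measure_bigsetU_ord//= -sumEFin; apply: eq_bigr => i _.
rewrite lebesgue_measure_itv/= lte_fin EFinB.
case: ltP => // vu; have -> : u i = v i by apply/le_anti; rewrite uv.
by rewrite -EFinB subrr.
Qed.

Lemma sum_length_disjoint_itvs n (u v : 'I_n -> R) (U : set R) :
  (forall i, u i <= v i) ->
  trivIset [set: 'I_n] (fun i => `]u i, v i[%classic) ->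
  measurable U -> (forall i, `]u i, v i[ `<=` U) ->
  ((\sum_(i < n) (v i - u i))%:E <= mu U)%E.
Proof.
move=> uv tI mU sub; rewrite -(measure_disjoint_itvs uv tI).
apply: le_measure; rewrite ?inE//; first exact: bigsetU_measurable.
by rewrite -bigcup_seq; apply: bigcup_sub => i _; exact: sub.
Qed.

Lemma derive0_small_increments y (s e : R) : 0 < e ->
  derivable y s 1 -> 'D_1 y s = 0 ->
  exists2 d : R, 0 < d & forall z, `|z - s| < d -> `|y z - y s| <= e * `|z - s|.
Proof.
move=> e0 dy Dy0.
have := dy; rewrite /derivable => /cvg_ex[l /= hl].
have l0 : l = 0 by rewrite -Dy0; apply/esym/cvg_lim.
subst l; move/cvgr0Pnorm_le : hl => /(_ _ e0) [d /= d0 hd].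
exists d => // z zd; have [->|zs] := eqVneq z s.
  by rewrite !subrr normr0 mulr0.
have zs0 : z - s != 0 by rewrite subr_eq0.
have := hd (z - s); rewrite /= sub0r normrN => /(_ zd zs0).
rewrite [_%:A]mulr1 subrK normrZ normfV ler_pdivrMl ?normr_gt0// mulrC; exact.
Qed.

(** A Cousin-type covering argument, which spares any Vitali covering.
    Around a point of zero derivative the increments of [y] are at most a
    small multiple of the length; the other points lie in an open set [U] of
    small measure, on which absolute continuity makes the increments small.
    Going from [a] to [b] by steps of these two kinds bounds the increment
    of [y] by any positive number. *)
Lemma ae_derive0_constant y : loc_abs_continuous y ->
  {ae mu, forall x, derivable y x 1 /\ 'D_1 y x = 0} ->
  forall a b, y a = y b.
Proof.
move=> acy aey a b.
wlog ab : a b / a < b => [wl|].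
  by have [|/wl ->//|->//] := ltgtP a b; exact: wl.
apply/esym/eqP; rewrite -subr_eq0 -normr_eq0.
apply/negPn/negP => nz0.
(* Half of the supposed increment is budgeted for each kind of step. *)
have nz : 0 < `|y b - y a| by rewrite lt_def nz0 normr_ge0.
pose e1 := `|y b - y a| / 2; have e10 : 0 < e1 by rewrite divr_gt0.
pose e2 := e1 / (b - a); have e20 : 0 < e2 by rewrite divr_gt0// subr_gt0.
have [d d0 acd] := acy _ _ (ltW ab) _ e10.
have [N [mN N0 subN]] := aey.
have [U [oU NU UNd]] : exists U : set R,
    [/\ open U, N `<=` U & (mu (U `\` N) < d%:E)%E].
  apply: lebesgue_regularity_outer => //.
  by have := N0; rewrite /= => ->; rewrite ltry.
have Ud : (mu U < d%:E)%E.
  have mU : measurable U by exact: open_measurable.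
  apply: le_lt_trans UNd; rewrite -[leRHS]adde0 -N0.
  have mUN : measurable (U `\` N) by exact: measurableD.
  rewrite -{1}(setDUK NU) setUC; exact: measureU2.
have mU : measurable U by exact: open_measurable.
(* The point [x] has been reached: the excess over the linear bound is carried
   by disjoint intervals inside [U]. *)
pose P x := exists n (u v : nat -> R), ordered_itvs n u v a x U /\
  `|y x - y a| <= e2 * (x - a) + \sum_(i < n) `|y (v i) - y (u i)|.
have Pa : P a.
  exists 0%N, (fun=> 0), (fun=> 0); split; first by split.
  by rewrite big_ord0 !subrr normr0 mulr0 addr0.
(* Any interval around [s] that is short enough can be crossed: inside [U] it is
   added to the family, otherwise the linear bound at [s] covers it. *)
have step s : a <= s -> exists2 dl : R, 0 < dl & forall x z,
    a <= x -> x <= s -> s <= z -> s - dl < x -> z < s + dl -> P x -> P z.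
  move=> as_; have [sN|sN] := pselect (N s).
    have [dl /= dl0 hdl] := oU _ (NU _ sN).
    exists dl => // x z ax xs sz sx zs [n [u [v [oi le]]]].
    exists n.+1, (fun i => if (i < n)%N then u i else x),
      (fun i => if (i < n)%N then v i else z); split.
      apply: ordered_itvs_rcons oi ax (le_trans xs sz) _.
      move=> t /=; rewrite in_itv/= => /andP[xt tz]; apply: hdl => /=.
      by rewrite ltr_distlC; apply/andP; split; lra.
    rewrite big_ord_recr/= ltnn.
    under eq_bigr do rewrite ltn_ord.
    have := ler_normD (y z - y x) (y x - y a).
    have -> : y z - y x + (y x - y a) = y z - y a by ring.
    have : e2 * (x - a) <= e2 * (z - a) by rewrite ler_pM2l//; lra.
    lra.
  have [dys Dys] : derivable y s 1 /\ 'D_1 y s = 0.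
    by apply: contrapT => h; apply: sN; apply: subN.
  have [dl dl0 hdl] := derive0_small_increments e20 dys Dys.
  exists dl => // x z ax xs sz sx zs [n [u [v [[bd mono sub] le]]]].
  exists n, u, v; split.
    split => // i ni; have [? ? ?] := bd _ ni; split => //; lra.
  have hx : `|y x - y s| <= e2 * (s - x).
    rewrite -[s - x]ger0_norm ?subr_ge0// [`|s - x|]distrC; apply: hdl.
    by rewrite ler0_norm; lra.
  have hz : `|y z - y s| <= e2 * (z - s).
    rewrite -[z - s]ger0_norm ?subr_ge0//; apply: hdl.
    by rewrite ger0_norm; lra.
  have := ler_distD (y s) (y z) (y x); rewrite [`|y s - y x|]distrC.
  have := ler_distD (y x) (y z) (y a).
  have -> : e2 * (z - a) = e2 * (z - s) + e2 * (s - x) + e2 * (x - a) by ring.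
  lra.
(* The supremum of the reached points can itself be crossed, so it is [b]. *)
pose S := [set x | a <= x <= b /\ P x].
have Sa : S a by split => //; rewrite lexx ltW.
have supS : has_sup S by split; [exists a|exists b => x [/andP[]]].
have as_ : a <= sup S by apply: ub_le_sup => //; case: supS.
have sb : sup S <= b by apply: ge_sup; [exists a|move=> x [/andP[]]].
have [dl dl0 hdl] := step _ as_.
have [x [/andP[ax xb] Px] sx] := sup_adherent dl0 supS.
have xs : x <= sup S by apply: ub_le_sup; [case: supS|split => //; apply/andP].
have Pb : P b.
  have [sbE|sb'] := eqVneq (sup S) b.
    by apply: (hdl x) => //; rewrite sbE// ltrDl.
  pose z := Num.min b (sup S + dl / 2).
  have sz : sup S < z by rewrite lt_min lt_neqAle sb' sb ltrDl divr_gt0.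
  have : z <= sup S.
    apply: ub_le_sup; first by case: supS.
    split.
      by rewrite ge_min lexx/= andbT; apply: ltW; apply: le_lt_trans sz.
    apply: (hdl x) => //; first exact: ltW.
    by rewrite gt_min; apply/orP; right; lra.
  by rewrite leNgt sz.
have [n [u [v [oi le]]]] := Pb.
have [bd mono sub] := oi.
have : \sum_(i < n) `|y (v i) - y (u i)| < e1.
  apply: acd => //; first by move=> i; exact: bd.
    exact: ordered_itvs_trivIset oi.
  rewrite -lte_fin; apply: le_lt_trans Ud.
  apply: sum_length_disjoint_itvs => //.
  - by move=> i; have [] := bd _ (ltn_ord i).
  - exact: ordered_itvs_trivIset oi.
  - by move=> i; exact: sub.
move: le; rewrite /e2 divfK ?subr_eq0 ?gt_eqF// /e1; lra.
Qed.

End zero_derivative.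

(** * Stability of absolute continuity *)

Section ac_closure.
Context {R : realType}.
Implicit Types y z w : R -> R.

(** All the stability properties below reduce to this domination of
    increments. *)
Lemma abs_continuous_comb (C a b : R) y z w :
  abs_continuous_itv a b y -> abs_continuous_itv a b z ->
  (forall s t, a <= s -> s <= t -> t <= b ->
     `|w t - w s| <= C * (`|y t - y s| + `|z t - z s|)) ->
  abs_continuous_itv a b w.
Proof.
move=> acy acz wC e e0.
pose D := `|C| + 1; have D0 : 0 < D by rewrite ltr_wpDl.
have e20 : 0 < e / D / 2 by rewrite !divr_gt0.
have [d1 d10 h1] := acy _ e20; have [d2 d20 h2] := acz _ e20.
exists (Num.min d1 d2); first by rewrite lt_min d10.
move=> n u v uv tI; rewrite lt_min.
move=> /andP[/(h1 _ _ _ uv tI) l1 /(h2 _ _ _ uv tI) l2].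
apply: (@le_lt_trans _ _ (D * (\sum_(i < n) `|y (v i) - y (u i)| +
                               \sum_(i < n) `|z (v i) - z (u i)|))).
  rewrite -big_split/= mulr_sumr; apply: ler_sum => i _.
  have [au uv' vb] := uv i; apply: le_trans (wC _ _ au uv' vb) _.
  by rewrite ler_wpM2r ?addr_ge0// /D; have := ler_norm C; lra.
rewrite mulrC -ltr_pdivlMr//; lra.
Qed.

Lemma loc_abs_continuous_continuous y : loc_abs_continuous y -> continuous y.
Proof.
move=> acy x; apply/cvgrPdist_lt => /= e e0.
have x1 : x - 1 <= x + 1 by lra.
have [d d0 hd] := acy _ _ x1 _ e0.
have key s t : x - 1 <= s -> s <= t -> t <= x + 1 -> t - s < d ->
    `|y t - y s| < e.
  move=> xs st tx tsd.
  have := hd 1%N (fun=> s) (fun=> t); rewrite !big_ord1; apply => //.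
  by apply/trivIsetP => i j _ _; rewrite !ord1 eqxx.
exists (Num.min 1 d) => /=; first by rewrite lt_min ltr01.
move=> t /=; rewrite lt_min => /andP[].
rewrite !(ltr_distlC x t) => /andP[? ?] /andP[? ?].
have [xt|tx] := leP x t; first by rewrite distrC; apply: key; lra.
by apply: key; lra.
Qed.

Lemma continuous_bounded_itv y (a b : R) : continuous y -> a <= b ->
  exists2 M : R, 0 < M & forall t, a <= t <= b -> `|y t| <= M.
Proof.
move=> cy ab.
have cn : {within `[a, b], continuous (fun t => `|y t|)}.
  apply: continuous_subspaceT => t; apply: cvg_norm; exact: cy.
have [c _ hc] := EVT_max ab cn.
exists (`|y c| + 1); first by rewrite ltr_wpDl.
move=> t tab; apply: (@le_trans _ _ `|y c|); last by rewrite lerDl.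
by apply: hc; rewrite in_itv.
Qed.

Lemma loc_abs_continuous_cst (c : R) : loc_abs_continuous (fun=> c).
Proof.
move=> a b ab e e0; exists 1 => // n u v _ _ _.
by rewrite big1 // => i _; rewrite subrr normr0.
Qed.

Lemma loc_abs_continuousD y z : loc_abs_continuous y -> loc_abs_continuous z ->
  loc_abs_continuous (fun x => y x + z x).
Proof.
move=> acy acz a b ab.
apply: (abs_continuous_comb (C := 1) (acy _ _ ab) (acz _ _ ab)).
move=> s t _ _ _; rewrite mul1r; apply: le_trans (ler_normD _ _).
by rewrite opprD addrACA.
Qed.

Lemma loc_abs_continuousM y z : loc_abs_continuous y -> loc_abs_continuous z ->
  loc_abs_continuous (fun x => y x * z x).
Proof.
move=> acy acz a b ab.
have [M M0 hM] := continuous_bounded_itv (loc_abs_continuous_continuous acy) ab.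
have [L L0 hL] := continuous_bounded_itv (loc_abs_continuous_continuous acz) ab.
apply: (abs_continuous_comb (C := M + L) (acy _ _ ab) (acz _ _ ab)).
move=> s t as_ st tb.
have -> : y t * z t - y s * z s = y t * (z t - z s) + z s * (y t - y s) by ring.
apply: le_trans (ler_normD _ _) _; rewrite !normrM.
have h1 : `|y t| * `|z t - z s| <= M * `|z t - z s|.
  by rewrite ler_wpM2r// hM//; apply/andP; split; lra.
have h2 : `|z s| * `|y t - y s| <= L * `|y t - y s|.
  by rewrite ler_wpM2r// hL//; apply/andP; split; lra.
have := mulr_ge0 (ltW M0) (normr_ge0 (y t - y s)).
have := mulr_ge0 (ltW L0) (normr_ge0 (z t - z s)).
lra.
Qed.

Lemma loc_abs_continuous_expR y : loc_abs_continuous y ->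
  loc_abs_continuous (fun x => expR (y x)).
Proof.
move=> acy a b ab.
have [M M0 hM] := continuous_bounded_itv (loc_abs_continuous_continuous acy) ab.
apply: (abs_continuous_comb (C := expR M) (acy _ _ ab) (acy _ _ ab)).
move=> s t as_ st tb.
have aux p q : `|p| <= M -> expR p - expR q <= expR M * `|p - q|.
  move=> pM; have -> : expR p - expR q = expR p * (1 - expR (q - p)).
    by rewrite mulrBr mulr1 -expRD subrKC.
  apply: (@le_trans _ _ (expR p * `|p - q|)).
    rewrite ler_wpM2l ?expR_ge0//; have := expR_ge1Dx (q - p).
    have := ler_norm (p - q); lra.
  by rewrite ler_wpM2r// ler_expR; apply: le_trans pM; exact: ler_norm.
have ht : `|y t| <= M by apply: hM; apply/andP; split; lra.
have hs : `|y s| <= M by apply: hM; apply/andP; split; lra.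
have h1 := aux _ (y s) ht; have h2 := aux _ (y t) hs; rewrite distrC in h2.
have := mulr_ge0 (expR_ge0 M) (normr_ge0 (y t - y s)).
by rewrite ler_norml => ?; apply/andP; split; lra.
Qed.

End ac_closure.

(** * Primitives of locally integrable functions *)

Section primitives.
Context {R : realType}.
Local Notation mu := (@lebesgue_measure R).
Implicit Types h k : R -> R.

Lemma ae_le_Rintegral (D : set R) (h k : R -> R) : measurable D ->
  mu.-integrable D (EFin \o h) -> mu.-integrable D (EFin \o k) ->
  {ae mu, forall x, D x -> h x <= k x} ->
  \int[mu]_(x in D) h x <= \int[mu]_(x in D) k x.
Proof.
move=> mD hi ki hk; rewrite -subr_ge0 -RintegralB//.
have kh : mu.-integrable D (EFin \o (fun x => k x - h x)).
  by have := @integrableB _ _ R mu D mD _ _ ki hi; apply: eq_integrable.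
rewrite /Rintegral (@ae_eq_integral _ _ _ mu D (fun t => `|k t - h t|%:E))//.
- by rewrite fine_ge0// integral_ge0.
- exact: measurable_int kh.
- exact: measurable_int (integrable_norm kh).
- apply: (@filterS _ _ (ae_filter_ringOfSetsType mu)) hk => t + Dt.
  move=> /(_ Dt) ht.
  by rewrite ger0_norm// subr_ge0.
Qed.

Lemma locally_integrable_itv h (a b : R) : locally_integrable [set: R] h ->
  mu.-integrable `[a, b] (EFin \o h).
Proof.
move=> [mh _ fin]; apply/integrableP; split.
  by apply/measurable_EFinP; exact: measurable_funS mh.
by have := fin `[a, b]%classic (@subsetT _ _) (@segment_compact _ a b).
Qed.

Lemma itv_locally_integrable h : measurable_fun [set: R] h ->
  (forall a b : R, mu.-integrable `[a, b] (EFin \o h)) ->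
  locally_integrable [set: R] h.
Proof.
move=> mh ih; split => //; first exact: openT.
move=> K _ cK; have [M [Mr hM]] := compact_bounded cK.
have KM : K `<=` `[- (M + 1), M + 1]%classic.
  move=> x Kx /=; rewrite in_itv/= -ler_norml.
  by apply: hM => //; rewrite ltrDl.
have /integrableP[_] := ih (- (M + 1)) (M + 1).
apply: le_lt_trans; apply: ge0_subset_integral => //.
- exact: compact_measurable.
- apply/measurable_EFinP; apply: measurableT_comp => //.
  exact: measurable_funS mh.
Qed.

Lemma locally_integrableM h k : locally_integrable [set: R] h -> continuous k ->
  locally_integrable [set: R] (fun x => h x * k x).
Proof.
move=> lh ck; have mk := continuous_measurable_fun ck.
have [mh _ _] := lh.
apply: itv_locally_integrable; first exact: measurable_funM.
move=> a b; have [ab|ba] := leP a b; last first.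
  by rewrite set_itv_ge ?bnd_simp -?ltNge//; exact: integrable_set0.
have [M M0 hM] := continuous_bounded_itv ck ab.
apply: (@le_integrable _ _ R mu _ _ _ (EFin \o (fun x => M * h x))) => //.
- by apply/measurable_EFinP; apply: measurable_funS (measurable_funM mh mk).
- move=> x /=; rewrite in_itv/= => abx; rewrite lee_fin !normrM (gtr0_norm M0).
  by rewrite mulrC ler_wpM2r// hM.
- exact: integrableZl (locally_integrable_itv a b lh).
Qed.

(** The signed integral of [h] from 0 to [x]: one of the two intervals has
    at most one point. *)
Definition primitive h (x : R) : R :=
  \int[mu]_(t in `[0, x]) h t - \int[mu]_(t in `[x, 0]) h t.

Lemma Rintegral_itv_split h (a b c : R) : locally_integrable [set: R] h ->
  a <= b -> b <= c ->
  \int[mu]_(t in `[a, c]) h t =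
  \int[mu]_(t in `[a, b]) h t + \int[mu]_(t in `[b, c]) h t.
Proof.
move=> lh ab bc; have ih := locally_integrable_itv _ _ lh.
rewrite -(@Rintegral_itv_obnd_cbnd _ b); last first.
  by apply: integrableS (ih b c) => //; apply: subset_itvr; rewrite bnd_simp.
rewrite -(@Rintegral_itvB _ h (BLeft a) (BRight c) b); first by rewrite subrKC.
- exact: ih.
- by rewrite bnd_simp.
- by rewrite bnd_simp.
Qed.

Lemma primitiveB h (a b : R) : locally_integrable [set: R] h -> a <= b ->
  primitive h b - primitive h a = \int[mu]_(t in `[a, b]) h t.
Proof.
move=> lh ab; rewrite /primitive.
have z (c d : R) : d < c -> \int[mu]_(t in `[c, d]) h t = 0.
  by move=> dc; rewrite set_itv_ge ?bnd_simp -?ltNge// Rintegral_set0.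
have z0 : \int[mu]_(t in `[0, 0]) h t = 0 by rewrite set_itv1 Rintegral_set1.
have [a0|a0] := leP 0 a.
  rewrite (Rintegral_itv_split lh a0 ab).
  have e c : 0 <= c -> \int[mu]_(t in `[c, 0]) h t = 0.
    by rewrite le_eqVlt => /orP[/eqP <-//|/z].
  by rewrite !e//; [ring|exact: le_trans ab].
have [b0|b0] := leP b 0.
  rewrite (Rintegral_itv_split lh ab b0) (z 0 a)//.
  have -> : \int[mu]_(t in `[0, b]) h t = 0.
    by move: b0; rewrite le_eqVlt => /orP[/eqP ->//|/z].
  by ring.
by rewrite (Rintegral_itv_split lh (ltW a0) (ltW b0)) (z 0 a)// (z b 0)//; ring.
Qed.

Lemma primitive0 h : primitive h 0 = 0.
Proof. by rewrite /primitive subrr. Qed.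

(** The increments over disjoint intervals add up to at most the integral of
    [|h|] over their union, which is small with its measure. *)
Lemma primitive_loc_abs_continuous h : locally_integrable [set: R] h ->
  loc_abs_continuous (primitive h).
Proof.
move=> lh a b ab e e0; have [mh _ _] := lh.
have ih : mu.-integrable setT (EFin \o (h \_ `[a, b])).
  rewrite -restrict_EFin; apply/(integrable_mkcond _ _).1 => //.
  exact: locally_integrable_itv.
have [d [d0 hd]] := integral_normr_continuous ih e0.
exists d => // n u v uv tI lt.
pose A := \big[setU/set0]_(i < n) `]u i, v i[%classic.
have mA : measurable A by exact: bigsetU_measurable.
apply: le_lt_trans (hd A mA _); last first.
  have muA : mu A = (\sum_(i < n) (v i - u i))%:E.
    by apply: measure_disjoint_itvs => // i; have [] := uv i.
  by have : (mu A < d%:E)%E by rewrite muA lte_fin.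
rewrite -lee_fin /Rintegral fineK; last first.
  apply: integrable_fin_num => //.
  by apply: integrableS (integrable_norm ih).
rewrite ge0_integral_bigsetU//=; last 3 first.
- exact: index_enum_uniq.
- by apply: sub_trivIset tI.
- apply/measurable_EFinP; apply: measurableT_comp => //.
  by have /integrableP[/measurable_EFinP mm _] := ih; exact: measurable_funS mm.
rewrite -sumEFin; apply: lee_sum => i _.
have [au ui vb] := uv i.
rewrite primitiveB//.
apply: (@le_trans _ _ (\int[mu]_(t in `[u i, v i]) `|h t|)%:E).
  by rewrite lee_fin le_normr_Rintegral//; exact: locally_integrable_itv.
rewrite /Rintegral fineK; last first.
  apply: integrable_fin_num => //.
  exact: integrable_norm (locally_integrable_itv _ _ lh).
rewrite integral_itv_bndoo; last first.
  apply/measurable_EFinP; apply: measurableT_comp => //.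
  exact: measurable_funS mh.
rewrite le_eqVlt; apply/orP; left; apply/eqP; apply: eq_integral => t.
rewrite inE/= in_itv/= => /andP[ut tv]; rewrite patchE mem_set//= in_itv/=.
by apply/andP; split; lra.
Qed.

(** At a Lebesgue point the derivative is computed on the integral from
    [x - 1], which differs from the primitive by a constant near [x]. *)
Lemma primitive_ae_derive h : locally_integrable [set: R] h ->
  {ae mu, forall x : R, is_derive x (1 : R) (primitive h) (h x)}.
Proof.
move=> lh; have := lebesgue_differentiation lh.
apply: (@filterS _ _ (ae_filter_ringOfSetsType mu)) => x lx.
have xx1 : x < x + 1 by lra.
have := @FTC1_lebesgue_pt _ h (BLeft (x - 1)) x (x + 1) xx1
  (locally_integrable_itv _ _ lh).
move=> /(_ _ lx)[|dF DF]; first by rewrite lte_fin; lra.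
apply: (@near_eq_is_derive _ _ _
  (fun y => (primitive h (x - 1) : R^o) + \int[mu]_(t in `[x - 1, y]) h t)).
  near=> y; rewrite -primitiveB ?subrKC//.
  by apply: ltW; near: y; apply: lt_nbhsr; lra.
have dF' : is_derive x (1 : R)
    (fun y => \int[mu]_(t in `[x - 1, y]) h t) (h x).
  by split; rewrite -?derive1E.
have dc := is_deriveD (is_derive_cst (primitive h (x - 1)) x (1 : R)) dF'.
by apply: is_derive_eq dc _; rewrite add0r.
Unshelve. all: by end_near. Qed.

End primitives.

(** * Variation of constants *)

Section variation_of_constants.
Context {R : realType}.
Local Notation mu := (@lebesgue_measure R).
Variables r q : R -> R.
Hypotheses (cr : continuous r) (r_gt0 : forall x, 0 < r x).
Hypothesis lq : locally_integrable [set: R] q.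
Implicit Types f y : R -> R.

(** The exponent of the integrating factor: [exp (- potential)] turns the
    equation into [(y exp (- Q))' = - (f / r) exp (- Q)], and the kernel of
    [G] is [exp (Q x - Q t) / r t]. *)
Definition potential (x : R) : R := primitive (fun t => q t / r t) x.
Local Notation Q := potential.

Lemma continuous_invr_coef : continuous (fun x => (r x)^-1).
Proof. by move=> x; apply: cvgV; [rewrite gt_eqF|exact: cr]. Qed.

Lemma locally_integrable_ratio f : locally_integrable [set: R] f ->
  locally_integrable [set: R] (fun t => f t / r t).
Proof. by move=> lf; exact: (locally_integrableM lf continuous_invr_coef). Qed.

Let lqr := locally_integrable_ratio lq.

Lemma potential_loc_abs_continuous : loc_abs_continuous Q.
Proof. exact: primitive_loc_abs_continuous lqr. Qed.

Lemma potential_continuous : continuous Q.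
Proof. exact: loc_abs_continuous_continuous potential_loc_abs_continuous. Qed.

Lemma potentialB (a b : R) : a <= b ->
  Q b - Q a = \int[mu]_(t in `[a, b]) (q t / r t).
Proof. by move=> ab; rewrite /Q primitiveB. Qed.

Lemma loc_abs_continuous_expNpotential :
  loc_abs_continuous (fun x => expR (- Q x)).
Proof.
apply: loc_abs_continuous_expR.
have -> : (fun x => - Q x) = (fun x => -1 * Q x).
  by apply/funext => x; rewrite mulN1r.
apply: loc_abs_continuousM (loc_abs_continuous_cst _) _.
exact: potential_loc_abs_continuous.
Qed.

Lemma continuous_expNpotential : continuous (fun x => expR (- Q x)).
Proof.
exact: loc_abs_continuous_continuous loc_abs_continuous_expNpotential.
Qed.

Lemma locally_integrable_source f : locally_integrable [set: R] f ->
  locally_integrable [set: R] (fun t => f t / r t * expR (- Q t)).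
Proof.
move=> lf; apply: locally_integrableM (locally_integrable_ratio lf) _.
exact: continuous_expNpotential.
Qed.

(** The sum of [y exp (- Q)] and of the primitive of [(f / r) exp (- Q)] is
    locally absolutely continuous with zero derivative almost everywhere,
    hence constant. *)
Lemma variation_of_constants f y (x t : R) : locally_integrable [set: R] f ->
  loc_abs_continuous y ->
  {ae mu, forall x : R, derivable y x 1 /\
                        - r x * 'D_1 y x + q x * y x = f x} ->
  x <= t ->
  y x * expR (- Q x) - y t * expR (- Q t) =
  \int[mu]_(s in `[x, t]) (f s / r s * expR (- Q s)).
Proof.
move=> lf acy aey xt.
pose g s := f s / r s * expR (- Q s).
have lg : locally_integrable [set: R] g by exact: locally_integrable_source.
pose w s := y s * expR (- Q s) + primitive g s.
have acw : loc_abs_continuous w.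
  apply: loc_abs_continuousD (primitive_loc_abs_continuous lg).
  exact: loc_abs_continuousM acy loc_abs_continuous_expNpotential.
suff aew : {ae mu, forall s : R, derivable w s 1 /\ 'D_1 w s = 0}.
  have := ae_derive0_constant acw aew x t.
  rewrite /w -(primitiveB lg xt).
  move: (primitive g x) (primitive g t) (y x * _) (y t * _) => gx gt yx yt; lra.
have aeQ := primitive_ae_derive lqr; have aeg := primitive_ae_derive lg.
have F := ae_filter_ringOfSetsType mu.
apply: filterS3 aey aeQ aeg => s [dy ye] dQ dg.
have dy' : is_derive s 1 y ('D_1 y s) by exact/derivableP.
have dN : is_derive s (1 : R) (fun x => - Q x) (- (q s / r s)).
  exact: is_deriveN.
have dE := @is_derive1_comp _ expR (fun x => - Q x) s _ _
  (is_derive_expR (- Q s)) dN.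
have dw := is_deriveD (is_deriveM dy' dE) dg.
have {}dw : is_derive s (1 : R) w 0.
  apply: is_derive_eq dw _; rewrite /g -ye /=.
  have rs0 : r s != 0 by rewrite gt_eqF.
  by rewrite /GRing.scale/=; field.
by split; [exact: ex_derive|exact: derive_val].
Qed.

Lemma solution_of_source f (c : R) : locally_integrable [set: R] f ->
  let y x :=
    expR (Q x) * (c - primitive (fun s => f s / r s * expR (- Q s)) x) in
  loc_abs_continuous y /\
  {ae mu, forall x : R, derivable y x 1 /\
                        - r x * 'D_1 y x + q x * y x = f x}.
Proof.
move=> lf y.
pose g s := f s / r s * expR (- Q s).
have lg : locally_integrable [set: R] g by exact: locally_integrable_source.
have -> : y = (fun x => expR (Q x) * (c + -1 * primitive g x)).
  by apply/funext => x; rewrite mulN1r.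
split.
  apply: loc_abs_continuousM.
    exact: loc_abs_continuous_expR potential_loc_abs_continuous.
  apply: loc_abs_continuousD (loc_abs_continuous_cst _) _.
  apply: loc_abs_continuousM (loc_abs_continuous_cst _) _.
  exact: primitive_loc_abs_continuous lg.
have aeQ := primitive_ae_derive lqr; have aeg := primitive_ae_derive lg.
have F := ae_filter_ringOfSetsType mu.
apply: filterS2 aeQ aeg => s dQ dg.
have dE := @is_derive1_comp _ expR Q s _ _ (is_derive_expR (Q s)) dQ.
have dZ := is_deriveD (is_derive_cst c s (1 : R))
  (is_deriveM (is_derive_cst (-1 : R) s (1 : R)) dg).
have dw := is_deriveM dE dZ.
set w := (fun x => _) in dw *.
split; first exact: ex_derive.
rewrite (@derive_val _ _ _ _ _ _ _ dw) /GRing.scale/= /g.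
have rs0 : r s != 0 by rewrite gt_eqF.
have : expR (Q s) * expR (- Q s) = 1 by rewrite -expRD subrr expR0.
rewrite -/g.
change ((cst c + cst (-1) * primitive g) s) with (c + -1 * primitive g s).
move=> EE; transitivity (f s * (expR (Q s) * expR (- Q s))).
  by field.
by rewrite EE mulr1.
Qed.

End variation_of_constants.

(** * The exponential kernel *)

Section exponential_kernel.
Context {R : realType}.
Local Notation mu := (@lebesgue_measure R).
Variable lam : R.
Hypothesis lam0 : 0 < lam.

(** The convolution kernel that dominates the kernel of [G] up to a
    constant. *)
Definition expker (x t : R) : R :=
  if x <= t then expR (- (lam * (t - x))) else 0.

Lemma expker_ge0 x t : 0 <= expker x t.
Proof. by rewrite /expker; case: ifP; rewrite ?expR_ge0. Qed.

Lemma expker_le1 x t : expker x t <= 1.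
Proof.
rewrite /expker; case: ifPn => // xt.
by rewrite -expR0 ler_expR oppr_le0 mulr_ge0 ?subr_ge0// ltW.
Qed.

Lemma measurable_expker : measurable_fun [set: R * R] (fun z => expker z.1 z.2).
Proof.
apply: measurable_fun_if => //.
- exact: measurable_fun_ler.
- apply: measurable_funTS; apply: measurableT_comp => //.
  apply: measurable_funN; apply: measurable_funM => //.
  exact: measurable_funB.
Qed.

Lemma measurable_expkerr x : measurable_fun [set: R] (expker x).
Proof. by have := measurableT_comp measurable_expker (pair1_measurable x). Qed.

Lemma integral_expkerl (t : R) : (\int[mu]_x (expker x t)%:E = (lam^-1)%:E)%E.
Proof.
(* the right end point is written - - t to match the substitution x -> - x *)
transitivity
  (\int[mu]_(x in `]-oo, (- - t)%R]) (expR (- (lam * (t - x))))%:E)%E.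
  rewrite opprK [RHS]integral_mkcond/=; apply: eq_integral => x _.
  rewrite patchE /expker; case: ifPn => xt; first by rewrite mem_set//= in_itv.
  by rewrite memNset//= in_itv/=; exact/negP.
have cexp : continuous (fun x : R => expR (- (lam * (t - x)))).
  move=> x; apply: continuous_comp; last exact: continuous_expR.
  apply: cvgN; apply: cvgM; first exact: cvg_cst.
  by apply: cvgB; [exact: cvg_cst|exact: cvg_id].
rewrite ge0_integration_by_substitutionNy; last 2 first.
- exact: continuous_subspaceT.
- by move=> x _; rewrite expR_ge0.
pose F x : R := - (lam^-1 * expR (- (lam * (t + x)))).
have dF (x : R) : is_derive x (1 : R) F (expR (- (lam * (t + x)))).
  have d1 : is_derive x (1 : R) (fun z => - (lam * (t + z))) (- lam).
    have h := is_deriveN (is_deriveM (is_derive_cst lam x (1 : R))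
      (is_deriveD (is_derive_cst t x (1 : R)) (is_derive_id x (1 : R)))).
    apply: is_derive_eq h _; rewrite /GRing.scale/= /cst; ring.
  have d2 := @is_derive1_comp _ expR (fun z => - (lam * (t + z))) x _ _
    (is_derive_expR _) d1.
  have h := is_deriveN (is_deriveM (is_derive_cst lam^-1 x (1 : R)) d2).
  apply: is_derive_eq h _; rewrite /GRing.scale/= /cst.
  have lam_neq0 : lam != 0 by rewrite gt_eqF.
  by field.
rewrite (@ge0_continuous_FTC2y _ _ F _ 0).
- by rewrite /F subrr mulr0 oppr0 expR0 mulr1 EFinN oppeK add0e.
- by move=> x _; rewrite /= expR_ge0.
- apply: continuous_subspaceT => x; apply: continuous_comp; last exact: cexp.
  by apply: continuousN.
- rewrite /F -oppr0 -[X in - X](mulr0 lam^-1).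
  apply: cvgN; apply: cvgM; first exact: cvg_cst.
  apply: (@cvg_comp _ _ _ (fun x => lam * (t + x)) (fun z => expR (- z))
    _ _ _ _ (@cvgr_expR R)).
  apply: gt0_cvgMry => //; apply/cvgryPge => A; near=> x.
  by rewrite addrC -lerBlDr; near: x; exact: nbhs_pinfty_ge.
- by move=> x _; exact: ex_derive.
- apply: cvg_at_right_filter; apply: differentiable_continuous.
  by apply/derivable1_diffP; have [] := dF (- t).
- by move=> x _; rewrite derive1E (@derive_val _ _ _ _ _ _ _ (dF x))/= opprK.
Unshelve. all: by end_near. Qed.

(** Tonelli: the inner integral over [x] no longer depends on [t]. *)
Lemma integral_expker_conv (f : R -> R) : measurable_fun [set: R] f ->
  (\int[mu]_x \int[mu]_t (expker x t * `|f t|)%:E =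
   (lam^-1)%:E * \int[mu]_t `|f t|%:E)%E.
Proof.
move=> mf.
transitivity (\int[mu]_t \int[mu]_x (expker x t * `|f t|)%:E)%E.
  apply: (@fubini_tonelli _ _ _ _ _ mu mu
    (fun z => (expker z.1 z.2 * `|f z.2|)%:E)).
  - apply/measurable_EFinP; apply: measurable_funM.
      exact: measurable_expker.
    by apply: measurableT_comp => //; exact: measurableT_comp.
  - by move=> z; rewrite lee_fin mulr_ge0// expker_ge0.
rewrite -ge0_integralZl//; last 2 first.
- by apply/measurable_EFinP; exact: measurableT_comp.
- by rewrite lee_fin invr_ge0 ltW.
apply: eq_integral => t _.
under eq_integral do rewrite EFinM.
rewrite ge0_integralZr//; first by rewrite integral_expkerl.
- apply/measurable_EFinP.
  by have := measurableT_comp measurable_expker (pair2_measurable t).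
- by move=> x _; rewrite lee_fin expker_ge0.
Qed.

(** Dominated convergence with majorant [|f|]: for fixed [t] the kernel
    vanishes once [u n > t], and decays exponentially as [u n] goes to
    [-oo]. *)
Lemma integral_expker_cvg (f : R -> R) (u : R^nat) :
  mu.-integrable setT (EFin \o f) ->
  (u @ \oo --> +oo) \/ (u @ \oo --> -oo) ->
  (\int[mu]_t (expker (u n) t * `|f t|)%:E @[n --> \oo] --> 0)%E.
Proof.
move=> fi uoo; have /integrableP[/measurable_EFinP mf _] := fi.
have -> : 0%E = (\int[mu]_(t in [set: R]) (cst 0 t))%E by rewrite integral0.
apply: (@dominated_cvg _ _ _ mu setT _ _ _ (fun t => `|f t|%:E)) => //.
- move=> n; apply/measurable_EFinP; apply: measurable_funM.
    exact: measurable_expkerr.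
  exact: measurableT_comp.
- move=> t _; apply/fine_cvgP; split; first exact: nearW.
  rewrite /comp/= -(mul0r `|f t|); apply: cvgM; last exact: cvg_cst.
  case: uoo => uoo.
    apply: cvg_near_cst; near=> n; rewrite /expker ifF//.
    apply/negbTE; rewrite -ltNge.
    by near: n; exact: (cvgry_gt uoo).
  apply: (@squeeze_cvgr _ _ _ _ (cst 0)
    (fun n => expR (- (lam * (t - u n))))).
  - near=> n; rewrite expker_ge0/= /expker.
    by case: ifP => // _; exact: expR_ge0.
  - exact: cvg_cst.
  - apply: (@cvg_comp _ _ _ (fun n => lam * (t - u n)) (fun z => expR (- z))
      _ _ _ _ (@cvgr_expR R)).
    apply/cvgryPge => A; near=> n.
    rewrite -ler_pdivrMl// lerBrDl -lerBrDr.
    by near: n; exact: (cvgrNy_le uoo).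
- exact: integrable_norm.
- move=> n t _; rewrite lee_fin normrM normr_id ger0_norm ?expker_ge0//.
  by rewrite ler_piMl// expker_le1.
Unshelve. all: by end_near. Qed.

End exponential_kernel.

(** * Growth of the primitive of q / r *)

Section potential_growth.
Context {R : realType}.
Local Notation mu := (@lebesgue_measure R).
Variables r q : R -> R.
Hypotheses (cr : continuous r) (r_gt0 : forall x, 0 < r x).
Hypothesis lq : locally_integrable [set: R] q.
Hypothesis q_ge0 : {ae mu, forall x : R, 0 <= q x}.
Local Notation Q := (potential r q).

Let lqr := locally_integrable_ratio cr r_gt0 lq.

Lemma potential_nondecreasing (a b : R) : a <= b -> Q a <= Q b.
Proof.
move=> ab; rewrite -subr_ge0 (potentialB cr r_gt0 lq ab).
have -> : 0 = \int[mu]_(t in `[a, b]) (0 : R).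
  by rewrite Rintegral_cst// mul0r.
apply: ae_le_Rintegral => //; first exact: integrable0.
  exact: locally_integrable_itv.
apply: (@filterS _ _ (ae_filter_ringOfSetsType mu)) q_ge0 => t qt _.
by rewrite divr_ge0// ltW.
Qed.

Lemma int_aroundE (x d : R) : 0 <= d ->
  int_around r q x d = (Q (x + d) - Q (x - d))%:E.
Proof.
move=> d0; rewrite (potentialB cr r_gt0 lq); last by lra.
rewrite /Rintegral fineK//; apply: integrable_fin_num => //.
exact: locally_integrable_itv lqr.
Qed.

(** Consecutive windows of length [2 * D] each add [beta]; the incomplete
    last one costs the term [- 1]. *)
Lemma potential_growth (D beta : R) : 0 < D -> 0 < beta ->
  (forall x, beta <= Q (x + D) - Q (x - D)) ->
  forall x t, x <= t -> beta * ((t - x) / (2 * D) - 1) <= Q t - Q x.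
Proof.
move=> D0 b0 hQ x t xt.
have step n : n%:R * beta <= Q (x + n%:R * (2 * D)) - Q x.
  elim: n => [|n ih]; first by rewrite !mul0r addr0 subrr.
  have := hQ (x + n%:R * (2 * D) + D).
  have -> : x + n%:R * (2 * D) + D + D = x + n.+1%:R * (2 * D).
    by rewrite -[n.+1%:R]natr1; ring.
  have -> : x + n%:R * (2 * D) + D - D = x + n%:R * (2 * D) by ring.
  have -> : n.+1%:R * beta = n%:R * beta + beta by rewrite -natr1; ring.
  by lra.
have D20 : 0 < 2 * D by rewrite mulr_gt0.
have s0 : 0 <= (t - x) / (2 * D) by rewrite divr_ge0 ?subr_ge0// ltW.
have /andP[n1 n2] := truncn_itv s0.
set n := Num.truncn _ in n1 n2.
apply: le_trans (_ : n%:R * beta <= _).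
  by rewrite mulrC ler_wpM2r ?(ltW b0)// lerBlDr natr1 ltW.
apply: le_trans (step n) _; rewrite lerD2r; apply: potential_nondecreasing.
by rewrite ler_pdivlMr// in n1; lra.
Qed.

Lemma potential_expker (D beta : R) : 0 < D -> 0 < beta ->
  (forall x, beta <= Q (x + D) - Q (x - D)) ->
  forall x t, x <= t ->
    expR (Q x - Q t) <= expR beta * expker (beta / (2 * D)) x t.
Proof.
move=> D0 b0 hQ x t xt; rewrite /expker xt -expRD ler_expR.
have := potential_growth D0 b0 hQ xt.
have -> : beta * ((t - x) / (2 * D) - 1) =
    beta / (2 * D) * (t - x) - beta by ring.
lra.
Qed.

End potential_growth.

(** * Uniqueness of solutions *)

Section uniqueness.
Context {R : realType}.
Local Notation mu := (@lebesgue_measure R).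
Variables r q : R -> R.
Hypotheses (cr : continuous r) (r_gt0 : forall x, 0 < r x).
Hypothesis lq : locally_integrable [set: R] q.
Hypothesis q_ge0 : {ae mu, forall x : R, 0 <= q x}.
Local Notation Q := (potential r q).

(** The difference of two solutions solves the homogeneous equation, so its
    value at [x] is its value at any [t >= x] times [exp (Q x - Q t) <= 1];
    letting [t] tend to [+oo] shows that it is 0. *)
Lemma solution_unique (f y z : R -> R) : locally_integrable [set: R] f ->
  is_solution r q f y -> is_solution r q f z -> y = z.
Proof.
move=> lf [acy aey yy _] [acz aez zy _]; apply/funext => x.
have c0 : (y t - z t @[t --> +oo] --> (0 : R)).
  by rewrite -(subr0 (0 : R)); exact: cvgB.
apply/eqP; rewrite -subr_eq0 -normr_le0 leNgt; apply/negP => d0.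
have dec t : x <= t -> `|y x - z x| <= `|y t - z t|.
  move=> xt.
  have := variation_of_constants cr r_gt0 lq lf acy aey xt.
  rewrite -(variation_of_constants cr r_gt0 lq lf acz aez xt) => e.
  have {}e : (y x - z x) * expR (- Q x) = (y t - z t) * expR (- Q t).
    move: e; move: (expR (- Q x)) (expR (- Q t)) (y x) (y t) (z x) (z t).
    by move=> *; lra.
  have -> : y x - z x = (y t - z t) * expR (- Q t + Q x).
    by rewrite expRD mulrA -e -mulrA -expRD addNr expR0 mulr1.
  have : expR (- Q t + Q x) <= expR 0.
    by rewrite ler_expR addrC subr_le0; exact: potential_nondecreasing.
  have := expR_gt0 (- Q t + Q x); rewrite expR0.
  move: (expR _) (y t - z t) => E w E0 E1.
  by rewrite normrM (gtr0_norm E0) ler_piMr.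
near +oo_R => t.
have : `|y x - z x| <= `|y t - z t|.
  by apply: dec; near: t; apply: nbhs_pinfty_ge; rewrite num_real.
rewrite leNgt => /negP; apply; near: t.
by move/cvgr0Pnorm_lt : c0; apply.
Unshelve. all: by end_near. Qed.

End uniqueness.

(** * The Green operator for r bounded below *)

Section green_function.
Context {R : realType}.
Local Notation mu := (@lebesgue_measure R).
Variables r q : R -> R.
Hypotheses (cr : continuous r) (r_gt0 : forall x, 0 < r x).
Hypothesis lq : locally_integrable [set: R] q.
Hypothesis q_ge0 : {ae mu, forall x : R, 0 <= q x}.
Local Notation Q := (potential r q).
Variables rho D beta : R.
Hypotheses (rho0 : 0 < rho) (D0 : 0 < D) (beta0 : 0 < beta).
Hypothesis rho_le : forall x, rho <= r x.
Hypothesis hQ : forall x, beta <= Q (x + D) - Q (x - D).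

Let lam := beta / (2 * D).
Let M := expR beta / rho.
Let lam0 : 0 < lam. Proof. by rewrite divr_gt0// mulr_gt0. Qed.
Let M0 : 0 < M. Proof. by rewrite divr_gt0// expR_gt0. Qed.

Variable f : R -> R.
Hypothesis fi : mu.-integrable setT (EFin \o f).
Let mf : measurable_fun setT f.
Proof. by have /integrableP[/measurable_EFinP] := fi. Qed.
Let lf : locally_integrable [set: R] f.
Proof. by apply: open_integrable_locally => //; exact: openT. Qed.

Let g t := f t / r t * expR (- Q t).
Let lg : locally_integrable [set: R] g.
Proof. exact: locally_integrable_source. Qed.
Let mg : measurable_fun setT g. Proof. by have [] := lg. Qed.

(** The function [G f] as a real-valued function. Writing the tail integral
    from [x] as a total minus a primitive exhibits it as locally absolutely
    continuous. *)
Definition green (x : R) : R :=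
  expR (Q x) * (\int[mu]_(t in `[0, +oo[) g t - primitive g x).

(** The only place where the lower bound of [r] and the growth of [Q] enter:
    together they bound the kernel of [G] by [M] times the exponential
    kernel. *)
Lemma source_le x t : x <= t ->
  `|expR (Q x) * g t| <= M * (expker lam x t * `|f t|).
Proof.
move=> xt; rewrite /g mulrCA -expRD normrM (gtr0_norm (expR_gt0 _)) mulrC.
rewrite normrM normfV (gtr0_norm (r_gt0 t)).
have h1 := potential_expker cr r_gt0 lq q_ge0 D0 beta0 hQ xt.
have h2 : (r t)^-1 <= rho^-1 by rewrite lef_pV2 ?posrE.
have -> : M * (expker lam x t * `|f t|) =
  (expR beta * expker lam x t) * (`|f t| * rho^-1) by rewrite /M; ring.
apply: ler_pM => //.
  by rewrite mulr_ge0// invr_ge0 ltW.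
by rewrite ler_wpM2l.
Qed.

Let integrable_expker x :
  mu.-integrable setT (fun t => (expker lam x t * `|f t|)%:E).
Proof.
apply: (@le_integrable _ _ R mu _ _ _ (EFin \o f)) => //.
- apply/measurable_EFinP; apply: measurable_funM.
    exact: measurable_expkerr.
  exact: measurableT_comp.
- move=> t _ /=; rewrite lee_fin normrM normr_id ger0_norm ?expker_ge0//.
  by rewrite ler_piMl// expker_le1.
Qed.

Let integrable_source x :
  mu.-integrable `[x, +oo[ (fun t => (expR (Q x) * g t)%:E).
Proof.
apply: (@le_integrable _ _ R mu _ _ _
  (fun t => (M * (expker lam x t * `|f t|))%:E)) => //.
- apply/measurable_EFinP; apply: measurable_funTS.
  exact: measurable_funM (measurable_cst _) mg.
- move=> t /=; rewrite in_itv/= andbT => xt; rewrite lee_fin.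
  apply: le_trans (source_le xt) _; exact: ler_norm.
- apply: (@integrableS _ _ R mu setT) => //.
  exact: (integrableZl _ M (integrable_expker x)).
Qed.

Let integrable_g x : mu.-integrable `[x, +oo[ (EFin \o g).
Proof.
have := @integrableZl _ _ R mu _ (measurable_itv _) (expR (- Q x)) _
  (integrable_source x).
apply: eq_integrable => // t _.
by rewrite -EFinM mulrA -expRD addNr expR0 mul1r.
Qed.

Let Rintegral_g x :
  \int[mu]_(t in `[x, +oo[) g t = \int[mu]_(t in `[0, +oo[) g t - primitive g x.
Proof.
have split_ (a b : R) : a <= b ->
    \int[mu]_(t in `[a, +oo[) g t =
    \int[mu]_(t in `[a, b]) g t + \int[mu]_(t in `[b, +oo[) g t.
  move=> ab; rewrite -(@Rintegral_itv_obnd_cbnd _ b); last first.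
    apply: integrableS (integrable_g b) => //.
    by apply: subset_itvr; rewrite bnd_simp.
  rewrite -(@Rintegral_itvB _ g (BLeft a) +oo%O b); first by rewrite subrKC.
  - exact: integrable_g.
  - by rewrite bnd_simp.
  - by [].
have [x0|x0] := leP 0 x.
  by rewrite (split_ _ _ x0) -(primitiveB lg x0) primitive0; ring.
by rewrite (split_ _ _ (ltW x0)) -(primitiveB lg (ltW x0)) primitive0; ring.
Qed.

Lemma G_green x : G r q f x = (green x)%:E.
Proof.
rewrite /G /green -Rintegral_g.
rewrite -RintegralZl//.
rewrite /Rintegral fineK; last first.
  by apply: integrable_fin_num => //; exact: integrable_source.
apply: eq_integral => t; rewrite inE/= in_itv/= andbT => xt.
congr EFin; transitivity ((r t)^-1 * expR (- (Q t - Q x)) * f t).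
  by rewrite (potentialB cr r_gt0 lq xt).
by rewrite opprB expRD /g; ring.
Qed.

Lemma green_le x :
  (`|green x|%:E <= M%:E * \int[mu]_t (expker lam x t * `|f t|)%:E)%E.
Proof.
rewrite -ge0_integralZl//; last 3 first.
- exact: measurable_int (integrable_expker x).
- by move=> t _; rewrite lee_fin mulr_ge0// expker_ge0.
- by rewrite lee_fin ltW.
have -> : `|green x|%:E =
    `| \int[mu]_(t in `[x, +oo[) (expR (Q x) * g t)%:E |%E.
  rewrite /green -Rintegral_g -RintegralZl//.
  by rewrite EFin_normr_Rintegral//; exact: integrable_source.
have mS := measurable_int _ (integrable_source x).
apply: le_trans (le_abse_integral _ _ mS) _ => //.
rewrite [leRHS](_ : _ =
  \int[mu]_t (M * (expker lam x t * `|f t|))%:E)%E; last first.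
  by apply: eq_integral => t _; rewrite EFinM.
have mR : measurable_fun setT (fun t => (M * (expker lam x t * `|f t|))%:E).
  by have := measurable_int _
    (@integrableZl _ _ R mu _ measurableT M _ (integrable_expker x)).
apply: (@le_trans _ _
  (\int[mu]_(t in `[x, +oo[) (M * (expker lam x t * `|f t|))%:E)%E).
  apply: ge0_le_integral => //.
  - exact: measurableT_comp.
  - by apply: measurable_funTS.
  - by move=> t /=; rewrite in_itv/= andbT => xt; rewrite lee_fin source_le.
apply: ge0_subset_integral => // t _.
by rewrite lee_fin mulr_ge0 ?(ltW M0)// mulr_ge0// expker_ge0.
Qed.

Lemma green_ode : loc_abs_continuous green /\
  {ae mu, forall x : R, derivable green x 1 /\
                        - r x * 'D_1 green x + q x * green x = f x}.
Proof. exact: solution_of_source. Qed.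

Lemma green_measurable : measurable_fun [set: R] green.
Proof.
apply: continuous_measurable_fun; apply: loc_abs_continuous_continuous.
by case: green_ode.
Qed.

Lemma green_norm1 : (norm1 green <= (M / lam)%:E * norm1 f)%E.
Proof.
rewrite /norm1 !Lnorm1 EFinM -muleA -integral_expker_conv//.
have mgr := green_measurable.
have mN : measurable_fun setT
    (fun x => (\int[mu]_t (expker lam x t * `|f t|)%:E)%E).
  have h := @measurable_fun_fubini_tonelli_F _ _ _ _ _ mu
    (fun z => (expker lam z.1 z.2 * `|f z.2|)%:E).
  apply: h.
  - apply/measurable_EFinP; apply: measurable_funM.
      exact: measurable_expker.
    by apply: measurableT_comp => //; exact: measurableT_comp.
  - by move=> z; rewrite lee_fin mulr_ge0// expker_ge0.
rewrite -ge0_integralZl//; last 2 first.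
- move=> x _; apply: integral_ge0 => t _.
  by rewrite lee_fin mulr_ge0// expker_ge0.
- by rewrite lee_fin ltW.
apply: ge0_le_integral => //.
- by apply: measurableT_comp => //; exact/measurable_EFinP.
- exact: measurable_funeM.
- by move=> x _; exact: green_le.
Qed.

Lemma green_Lfun : green \in Lfun mu 1.
Proof.
apply/Lfun1_integrable/integrableP; split.
  by apply/measurable_EFinP; exact: green_measurable.
have := green_norm1; rewrite /norm1 !Lnorm1 => /le_lt_trans; apply.
apply: lte_mul_pinfty => //; first by rewrite lee_fin divr_ge0// ltW.
by have /integrableP[] := fi.
Qed.

Lemma green_cvg (u : R^nat) : (u @ \oo --> +oo) \/ (u @ \oo --> -oo) ->
  green (u n) @[n --> \oo] --> (0 : R).
Proof.
move=> uoo; apply/norm_cvg0P.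
have /(cvgeZl (y := M%:E)) := integral_expker_cvg lam0 fi uoo.
rewrite mule0 => /(_ isT) h.
apply: (@fine_cvg _ _ _ _ (fun n => `|green (u n)|%:E) 0).
apply: (@squeeze_cvge _ _ _ _ (cst 0%E)) h => //; last exact: cvg_cst.
by near=> n; rewrite lee_fin normr_ge0/= green_le.
Unshelve. all: by end_near. Qed.

Lemma green_solution : is_solution r q f green.
Proof.
have [ac ae] := green_ode; split => //.
- by apply/cvg_pinftyP => u uoo; apply: green_cvg; left.
- by apply/cvg_ninftyP => u uoo; apply: green_cvg; right.
Qed.

End green_function.

(** * Necessity of a positive lower bound for r *)

Section gliding_hump.
Context {R : realType}.
Local Notation mu := (@lebesgue_measure R).

(** The sum of the humps has integral [\sum_n c n], so it is integrable; it
    may be infinite on a null set, where [fine] replaces it by 0, so that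
    the lower bound holds almost everywhere only. *)
Lemma exists_L1_humps (c t e : R^nat) :
  (forall n, 0 < e n) -> (forall n, 0 <= c n) ->
  (\sum_(n <oo) (c n)%:E < +oo)%E ->
  exists2 f : R -> R, f \in Lfun mu 1 & forall n,
    {ae mu, forall x : R, `[t n, t n + e n]%classic x -> c n / e n <= f x}.
Proof.
move=> e0 c0 csum.
pose J n := `[t n, t n + e n]%classic : set R.
pose h n x := (c n / e n * \1_(J n) x)%:E : \bar R.
have h0 n x : (0 <= h n x)%E by rewrite lee_fin !mulr_ge0// invr_ge0 ltW.
have mh n : measurable_fun setT (h n).
  apply/measurable_EFinP; apply: measurable_funM; first exact: measurable_cst.
  exact: measurable_indic (measurable_itv _).
pose F x := (\sum_(n <oo) h n x)%E.
have F0 x : (0 <= F x)%E by apply: nneseries_ge0.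
have mF : measurable_fun setT F by exact: ge0_emeasurable_sum.
have intF : (\int[mu]_x F x < +oo)%E.
  rewrite integral_nneseries//.
  rewrite (@eq_eseriesr _ _ (fun n => (c n)%:E))// => n _.
  rewrite /h; under eq_integral do rewrite EFinM.
  rewrite ge0_integralZl//; last 2 first.
  - by apply/measurable_EFinP; exact: measurable_indic (measurable_itv _).
  - by rewrite lee_fin mulr_ge0// invr_ge0 ltW.
  rewrite integral_indic//; last exact: measurable_itv.
  have muI : mu (J n) = (e n)%:E.
    rewrite lebesgue_measure_itv/= lte_fin ltrDl e0.
    by rewrite -EFinB addrAC subrr add0r.
  rewrite setIT; apply: (@etrans _ _ ((c n / e n)%:E * mu (J n))%E) => //.
  by rewrite muI -EFinM divfK// gt_eqF.
have iF : mu.-integrable setT F.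
  apply/integrableP; split => //.
  rewrite (@eq_integral _ _ _ mu _ F)//.
  by move=> x _; rewrite gee0_abs.
exists (fine \o F).
  apply/Lfun1_integrable; apply: le_integrable iF => //.
    apply/measurable_EFinP; apply: measurableT_comp => //;
      exact: fine_measurable.
  move=> x _ /=; rewrite (gee0_abs (F0 x)).
  by case: (F x) (F0 x) => [s s0| |//] /=; rewrite ?leey// lee_fin ger0_norm.
move=> n; have := integrable_ae measurableT iF.
apply: (@filterS _ _ (ae_filter_ringOfSetsType mu)) => x /(_ I) Fx Ix.
rewrite -lee_fin /= fineK//.
apply: (@le_trans _ _ (h n x)); first by rewrite /h indicE mem_set// mulr1.
have := @nneseries_lim_ge R (fun n => h n x) xpredT 0%N n.+1
  (fun k _ _ => h0 k x).
apply: le_trans; rewrite big_mkord big_ord_recr/= leeDr//.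
exact: sume_ge0.
Qed.

End gliding_hump.

Section necessity.
Context {R : realType}.
Local Notation mu := (@lebesgue_measure R).
Variables r q : R -> R.
Hypotheses (cr : continuous r) (r_gt0 : forall x, 0 < r x).
Hypothesis lq : locally_integrable [set: R] q.
Hypothesis q_ge0 : {ae mu, forall x : R, 0 <= q x}.
Local Notation Q := (potential r q).

Lemma r0_ge0 : 0 <= r0 r.
Proof.
by apply: lb_le_inf; [exists (r 0), 0|move=> _ [x _ <-]; exact: ltW].
Qed.

Lemma r0_le x : r0 r <= r x.
Proof. by apply: ge_inf; [exists 0 => _ [y _ <-]; exact: ltW|exists x]. Qed.

(** A positive continuous function is bounded away from 0 on compact
    intervals, so a zero infimum is only approached at infinity. *)
Lemma small_coef_far (d M : R) : r0 r = 0 -> 0 < d -> 0 <= M ->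
  exists2 t : R, M < `|t| & r t < d.
Proof.
move=> r00 d0 M0.
have MM : - M <= M by lra.
have [c _ hc] := EVT_min MM (continuous_subspaceT cr).
have m0 : 0 < Num.min d (r c) by rewrite lt_min d0 r_gt0.
have : r0 r < Num.min d (r c) by rewrite r00.
case/inf_lt; first by exists (r 0), 0.
move=> _ [t _ <-]; rewrite lt_min => /andP[td tc]; exists t => //.
rewrite ltNge; apply/negP; rewrite ler_norml => tM.
by have := hc t; rewrite in_itv/= tM => /(_ isT); rewrite leNgt tc.
Qed.

Lemma small_coef_itv_far (d M : R) : r0 r = 0 -> 0 < d -> 0 <= M ->
  exists p : R * R, [/\ 0 < p.2, M < `|p.1|, M < `|p.1 + p.2|,
    Q (p.1 + p.2) - Q p.1 <= 1 &
    forall s, p.1 <= s <= p.1 + p.2 -> r s <= d].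
Proof.
move=> r00 d0 M0; have [t Mt rt] := small_coef_far r00 d0 M0.
have cQ := potential_continuous cr r_gt0 lq.
have ct : (t + e : R) @[e --> (0 : R)^'+] --> t.
  apply: cvg_at_right_filter; rewrite -{2}(addr0 t).
  by apply: cvgD; [exact: cvg_cst|exact: cvg_id].
have [dl /= dl0 hdl] := cvgr_lt (r t) (@cr t) d rt.
have : \forall e \near (0 : R)^'+, [/\ 0 < e, M < `|t + e|,
    Q (t + e) - Q t <= 1 & forall s, t <= s <= t + e -> r s <= d].
  near=> e; split => //.
  - near: e; apply: (cvgr_gt `|t|) => //; exact: cvg_norm ct.
  - rewrite lerBlDr; near: e; apply: (cvgr_le (Q t)); last by rewrite ltrDr.
    exact: (cvg_comp _ _ ct (cQ t)).
  move=> s /andP[ts ste]; apply/ltW/hdl.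
  rewrite /= distrC ger0_norm ?subr_ge0//.
  rewrite ltrBlDl; apply: le_lt_trans ste _; rewrite ltrD2l.
  by near: e; exact: nbhs_right_lt.
move=> /filter_ex[e [e0 Me Qe re]].
by exists (t, e).
Unshelve. all: by end_near. Qed.

(** Gliding hump. If the infimum were 0, take intervals of length [e n]
    going to infinity on which [r <= c n] and [Q] grows by at most 1, and
    [f] with humps of height [c n / e n] there: its norm is at most the sum
    of the [c n], but each integral of [f / r] over an interval is at least
    1. By variation of constants a solution cannot then be small at both
    ends of the intervals. *)
Lemma solvable_r0_gt0 :
  (forall f : R -> R, f \in Lfun mu 1 -> exists y, is_solution r q f y) ->
  0 < r0 r.
Proof.
move=> sol; rewrite lt_def r0_ge0 andbT; apply/negP => /eqP r00.
pose c n : R := (2 ^ (n + 1))%:R^-1.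
have c_gt0 n : 0 < c n by rewrite invr_gt0 ltr0n expn_gt0.
have csum : (\sum_(n <oo) (c n)%:E < +oo)%E.
  have := @cvg_geometric_eseries_half R 1 0.
  rewrite /eseries/=; under eq_fun do under eq_bigr do rewrite div1r.
  by move/cvg_lim => ->//; rewrite ltry.
have /choice[p hp] n := small_coef_itv_far r00 (c_gt0 n) (ler0n R n).
pose t n := (p n).1; pose e n := (p n).2.
have e0 n : 0 < e n by case: (hp n).
have [f fL hf] := @exists_L1_humps R c t e e0 (fun n => ltW (c_gt0 n)) csum.
have fi := (Lfun1_integrable _ _).1 fL.
have lf : locally_integrable [set: R] f.
  by apply: open_integrable_locally => //; exact: openT.
have [y [acy aey yy yNy]] := sol f fL.
have key n : expR (-1) <= `|y (t n)| + `|y (t n + e n)|.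
  have tt : t n <= t n + e n by rewrite lerDl ltW.
  have [en0 _ _ Qn rn] := hp n.
  have vc := variation_of_constants cr r_gt0 lq lf acy aey tt.
  pose W := expR (- Q (t n + e n)).
  have low :
      W <= \int[mu]_(s in `[t n, t n + e n]) (f s / r s * expR (- Q s)).
    have -> : W = \int[mu]_(s in `[t n, t n + e n]) (W / e n).
      have muI : mu `[t n, t n + e n]%classic = (e n)%:E.
        rewrite lebesgue_measure_itv/= lte_fin ltrDl e0.
        by rewrite -EFinB addrAC subrr add0r.
      rewrite Rintegral_cst//; apply: (@etrans _ _ (W / e n * fine (e n)%:E)).
        by rewrite /= divfK// gt_eqF.
      by rewrite -muI.
    apply: ae_le_Rintegral => //.
    - apply: continuous_compact_integrable; first exact: segment_compact.
      by apply: continuous_subspaceT => x; exact: cvg_cst.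
    - apply: locally_integrable_itv; exact: locally_integrable_source.
    have := hf n.
    apply: (@filterS _ _ (ae_filter_ringOfSetsType mu)) => s + Is.
    move=> /(_ Is) fs.
    have Is' : t n <= s <= t n + e n by move: Is; rewrite /= in_itv.
    have rs := rn _ Is'.
    rewrite mulrC; apply: ler_pM.
    - by rewrite invr_ge0 ltW.
    - exact: expR_ge0.
    - rewrite ler_pdivlMr//; apply: le_trans fs.
      by rewrite mulrC ler_wpM2r// invr_ge0 ltW.
    - rewrite ler_expR lerN2; apply: potential_nondecreasing => //.
      by case/andP: Is'.
  have h1 : expR (-1) <= W * expR (Q (t n)).
    by rewrite -expRD ler_expR addrC -opprB lerN2.
  have h2 : W * expR (Q (t n)) <=
      (y (t n) * expR (- Q (t n)) - y (t n + e n) * W) * expR (Q (t n)).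
    by rewrite ler_wpM2r ?expR_ge0// vc.
  have h3 : (y (t n) * expR (- Q (t n)) - y (t n + e n) * W) * expR (Q (t n)) =
      y (t n) - y (t n + e n) * (W * expR (Q (t n))).
    have : expR (- Q (t n)) * expR (Q (t n)) = 1.
      by rewrite -expRD addNr expR0.
    move: (expR (- Q (t n))) (expR (Q (t n))) (y (t n)) (y (t n + e n)).
    by move=> a b u v ab; rewrite mulrBl -mulrA ab mulr1 mulrA.
  have W1 : W * expR (Q (t n)) <= 1.
    rewrite -expRD -expR0 ler_expR addrC subr_le0.
    exact: potential_nondecreasing.
  apply: le_trans h1 _; apply: le_trans h2 _; rewrite h3.
  apply: le_trans (ler_norm _) _; apply: le_trans (ler_normB _ _) _.
  rewrite lerD2l normrM ler_piMr// ger0_norm// mulr_ge0 ?expR_ge0//.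
have e10 : 0 < expR (-1) / 2 :> R by rewrite divr_gt0// expR_gt0.
have [A hA] : exists A : R, forall x, A < x -> `|y x| < expR (-1) / 2.
  have /cvgr0Pnorm_lt/(_ _ e10) [A [_ hA]] := yy.
  by exists A.
have [B hB] : exists B : R, forall x, x < B -> `|y x| < expR (-1) / 2.
  have /cvgr0Pnorm_lt/(_ _ e10) [B [_ hB]] := yNy.
  by exists B.
pose n := (Num.truncn (Num.max `|A| `|B|)).+1.
have nM : Num.max `|A| `|B| < n%:R by exact: truncnS_gt.
have small x : n%:R < `|x| -> `|y x| < expR (-1) / 2.
  move=> nx; have : Num.max `|A| `|B| < `|x| by exact: lt_trans nx.
  rewrite gt_max => /andP[Ax Bx].
  have [x0|x0] := leP 0 x.
    rewrite (ger0_norm x0) in Ax.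
    by apply: hA; apply: le_lt_trans Ax; exact: ler_norm.
  apply: hB; rewrite (ltr0_norm x0) in Bx.
  have := ler_norm (- B); rewrite normrN; lra.
have [_ M1 M2 _ _] := hp n.
have := key n; have := small _ M1; have := small _ M2.
by rewrite -/(t n) -/(e n); lra.
Qed.

End necessity.

(** * The window radius d and the operator norm *)

Section window_radius.
Context {R : realType}.
Local Notation mu := (@lebesgue_measure R).
Variables r q : R -> R.
Hypotheses (cr : continuous r) (r_gt0 : forall x, 0 < r x).
Hypothesis lq : locally_integrable [set: R] q.
Hypothesis q_ge0 : {ae mu, forall x : R, 0 <= q x}.
Local Notation Q := (potential r q).

Lemma int_around_lower_bound (a : R) : 0 < a ->
  (0 < ereal_inf (range (fun x : R => int_around r q x a)))%E ->
  exists2 beta : R, 0 < beta & forall x, beta <= Q (x + a) - Q (x - a).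
Proof.
move=> a0; set m := ereal_inf _ => m0.
have mle x : (m <= (Q (x + a) - Q (x - a))%:E)%E.
  rewrite -(int_aroundE cr r_gt0 lq x (ltW a0)).
  by apply: ereal_inf_lbound; exists x.
have mfin : m \is a fin_num.
  rewrite ge0_fin_numE ?(ltW m0)//; apply: le_lt_trans (mle 0) _.
  by rewrite ltry.
exists (fine m); first by rewrite -lte_fin fineK.
by move=> x; rewrite -lee_fin fineK.
Qed.

(** Positivity is what makes the bound on the norm of [G] read [+oo], and
    not [+oo * 0 = 0], when [r0 r = 0]. *)
Lemma d_fun_gt0 x : (0 < d_fun r q x)%E.
Proof.
have cQ := potential_continuous cr r_gt0 lq.
have [e e0 Qe] : exists2 e : R, 0 < e & Q (x + e) - Q (x - e) < 2.
  have c1 : (x + e : R) @[e --> (0 : R)^'+] --> x.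
    apply: cvg_at_right_filter; rewrite -{2}(addr0 x).
    by apply: cvgD; [exact: cvg_cst|exact: cvg_id].
  have c2 : (x - e : R) @[e --> (0 : R)^'+] --> x.
    apply: cvg_at_right_filter; rewrite -{2}(subr0 x).
    by apply: cvgB; [exact: cvg_cst|exact: cvg_id].
  have c3 : (Q (x + e) - Q (x - e) : R) @[e --> (0 : R)^'+] --> Q x - Q x.
    apply: cvgB; first exact: (cvg_comp _ _ c1 (cQ x)).
    exact: (cvg_comp _ _ c2 (cQ x)).
  have : \forall e \near (0 : R)^'+, 0 < e /\ Q (x + e) - Q (x - e) < 2.
    near=> e; split => //.
    by near: e; apply: (cvgr_lt (Q x - Q x)) => //; rewrite subrr.
  by move=> /filter_ex[e [? ?]]; exists e.
apply: (@lt_le_trans _ _ e%:E); first by rewrite lte_fin.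
apply: le_ereal_inf_tmp => _ [d [d0 Hd] <-].
rewrite lee_fin leNgt; apply/negP => de.
move: Hd; rewrite (int_aroundE cr r_gt0 lq _ (ltW d0)) => -[Hd].
have h1 : Q (x + d) <= Q (x + e) by apply: potential_nondecreasing => //; lra.
have h2 : Q (x - e) <= Q (x - d) by apply: potential_nondecreasing => //; lra.
lra.
Unshelve. all: by end_near. Qed.

Lemma d0_gt0 : (0 < d0 r q)%E.
Proof.
by apply: lt_le_trans (d_fun_gt0 0) _; apply: ereal_sup_ubound; exists 0.
Qed.

(** As [d_fun r q x] is an infimum, an admissible radius is only found below
    [2 * D], not below [D]; this only affects the absolute constant. *)
Lemma d0_growth (D : R) : d0 r q = D%:E ->
  forall x, 2 <= Q (x + 2 * D) - Q (x - 2 * D).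
Proof.
move=> dD x; have D0 : 0 < D by rewrite -lte_fin -dD d0_gt0.
have : (d_fun r q x < (2 * D)%:E)%E.
  apply: (@le_lt_trans _ _ D%:E); last by rewrite lte_fin; lra.
  by rewrite -dD; apply: ereal_sup_ubound; exists x.
move=> /ereal_inf_lt[_ [d [d_gt0 Hd] <-]]; rewrite lte_fin => dD2.
move: Hd; rewrite (int_aroundE cr r_gt0 lq _ (ltW d_gt0)) => -[Hd].
have h1 : Q (x + d) <= Q (x + 2 * D).
  by apply: potential_nondecreasing => //; lra.
have h2 : Q (x - 2 * D) <= Q (x - d).
  by apply: potential_nondecreasing => //; lra.
lra.
Qed.

(** When both [r0 r] and [d0 r q] are positive and finite, this is the bound
    of [green_norm1] for windows of half-length [2 * D] over which [Q] grows
    by 2, which gives [exp 2 / r0 * (2 * (2 * D)) / 2]. *)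
Lemma opnorm_G_le : (opnorm11 (G r q) <=
  (2 * expR 2)%:E * (r0 r)%:E^-1 * d0 r q)%E.
Proof.
have [r00|r00] := eqVneq (r0 r) 0.
  rewrite r00 inve0 gt0_muley ?lte_fin ?mulr_gt0 ?expR_gt0//.
  by rewrite gt0_mulye ?d0_gt0// leey.
have r0_gt0 : 0 < r0 r by rewrite lt_def r00 r0_ge0.
rewrite inver (negbTE r00) -EFinM.
have C0 : 0 < 2 * expR 2 / r0 r by rewrite divr_gt0// mulr_gt0// expR_gt0.
case dE : (d0 r q) d0_gt0 => [D| |//]; last first.
  by rewrite gt0_muley ?lte_fin// leey.
rewrite lte_fin => D0.
apply: ereal_inf_lbound; exists (2 * expR 2 / r0 r * D) => //.
split; first by rewrite mulr_ge0 ?ltW.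
have D20 : 0 < 2 * D by rewrite mulr_gt0.
have growth := d0_growth dE.
move=> f /Lfun1_integrable fi.
have -> : G r q f = EFin \o green r q f.
  apply/funext => x.
  apply: (@G_green _ _ _ cr r_gt0 lq q_ge0 (r0 r) (2 * D) 2) => //.
  exact: r0_le.
have gL : green r q f \in Lfun mu 1.
  apply: (@green_Lfun _ _ _ cr r_gt0 lq q_ge0 (r0 r) (2 * D) 2) => //.
  exact: r0_le.
split; first exact/Lfun1_integrable.
apply: le_trans (@green_norm1 _ _ _ cr r_gt0 lq q_ge0 (r0 r) (2 * D) 2
  _ _ _ _ growth _ fi) _ => //.
  exact: r0_le.
rewrite le_eqVlt; apply/orP; left; apply/eqP; congr (_%:E * _)%E.
by field; rewrite r00 gt_eqF.
Qed.

Lemma r0_gt0_correctly_solvable (a beta : R) : 0 < a -> 0 < beta ->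
  (forall x, beta <= Q (x + a) - Q (x - a)) ->
  0 < r0 r -> correctly_solvable r q.
Proof.
move=> a0 beta0 growth r0_gt0; have rle := r0_le r_gt0.
have locf f : f \in Lfun mu 1 -> locally_integrable [set: R] f.
  move=> /Lfun1_integrable fi.
  by apply: open_integrable_locally => //; exact: openT.
have gsol f : f \in Lfun mu 1 -> is_solution r q f (green r q f).
  move=> /Lfun1_integrable fi.
  exact: (@green_solution _ _ _ cr r_gt0 lq q_ge0 (r0 r) a beta).
split=> [f fL|].
  exists (green r q f); split.
    split; first exact: gsol.
    have /Lfun1_integrable fi := fL.
    exact: (@green_Lfun _ _ _ cr r_gt0 lq q_ge0 (r0 r) a beta).
  move=> z [zsol _].
  exact: (solution_unique cr r_gt0 lq q_ge0 (locf _ fL) (gsol _ fL) zsol).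
exists (expR beta / r0 r / (beta / (2 * a))).
  by rewrite divr_gt0// divr_gt0 ?expR_gt0 ?mulr_gt0.
move=> f y fL ysol _.
rewrite (solution_unique cr r_gt0 lq q_ge0 (locf _ fL) ysol (gsol _ fL)).
have /Lfun1_integrable fi := fL.
exact: (@green_norm1 _ _ _ cr r_gt0 lq q_ge0 (r0 r) a beta).
Qed.

End window_radius.

(* In \bar R, 0^-1 = +oo, so the last bound reads _ <= +oo when r0 r = 0. *)
Theorem theorem2p7 (R : realType) :
  exists2 c : R, 0 < c &
    forall r q : R -> R,
      continuous r -> (forall x : R, 0 < r x) ->
      locally_integrable [set: R] q ->
      {ae @lebesgue_measure R, forall x : R, 0 <= q x} ->
      (exists2 a : R, 0 < a &
         (0 < ereal_inf (range (fun x : R => int_around r q x a)))%E) ->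
      (correctly_solvable r q <-> 0 < r0 r) /\
      (opnorm11 (G r q) <= c%:E * (r0 r)%:E^-1 * d0 r q)%E.
Proof.
exists (2 * expR 2); first by rewrite mulr_gt0// expR_gt0.
move=> r q cr r_gt0 lq q_ge0 [a a0 ha]; split; last exact: opnorm_G_le.
have [beta beta0 growth] := int_around_lower_bound cr r_gt0 lq a0 ha.
split=> [[sol _]|]; last exact: r0_gt0_correctly_solvable growth.
apply: (solvable_r0_gt0 cr r_gt0 lq q_ge0) => f /sol[y [[ysol _] _]].
by exists y.
Qed.
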